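(* Let $m,n\ge 1$ and let $A=[A_{i,j}]_{i,j=1}^m\in \mathbb{M}_m(\mathbb{M}_n)$ be positive semidefinite. Then, with the same choice of sign on both sides (and for each of the two choices), \[ (\mathrm{tr}\, A)I_{mn} \pm (\mathrm{tr}_2 A)\otimes I_n \ \ge\ A \pm I_m\otimes (\mathrm{tr}_1 A). \] Equivalently, for each choice of sign, \[ (\mathrm{tr}\, A)I_{mn} - A \ \ge\ \pm\bigl( I_m\otimes (\mathrm{tr}_1 A) - (\mathrm{tr}_2 A)\otimes I_n\bigr). \]
   Context: $\mathbb{M}_n$ is the set of $n\times n$ complex matrices, $I_n$ is the identity matrix of order $n$. $\mathbb{M}_m(\mathbb{M}_n)$ is the set of complex $mn\times mn$ matrices partitioned into $m\times m$ blocks, each block in $\mathbb{M}_n$; an element is written $A=[A_{i,j}]_{i,j=1}^m$ with $A_{i,j}\in\mathbb{M}_n$. For Hermitian matrices $X,Y$ of the same order, $X\ge Y$ means $X-Y$ is positive semidefinite. The tensor (Kronecker) product of $X=[x_{ij}]$ and $Y$ is the block matrix $X\otimes Y$ whose $(i,j)$-block is $x_{ij}Y$. The partial traces of $A=[A_{i,j}]_{i,j=1}^m\in\mathbb{M}_m(\mathbb{M}_n)$ are $\mathrm{tr}_1 A=\sum_{i=1}^m A_{i,i}\in\mathbb{M}_n$ and $\mathrm{tr}_2 A=[\mathrm{tr}\,A_{i,j}]_{i,j=1}^m\in\mathbb{M}_m$, where $\mathrm{tr}$ is the ordinary trace. *)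

(* Defs.v *)
From mathcomp Require Import all_boot all_order all_algebra.
From mathcomp Require Import complex mxtens.
From mathcomp Require Import reals.

Set Implicit Arguments.
Unset Strict Implicit.
Unset Printing Implicit Defensive.

Import Order.TTheory GRing.Theory Num.Theory.
Local Open Scope ring_scope.
Local Open Scope sesquilinear_scope.

(* In a numClosedFieldType, [0 <= z] entails that z is real. *)
Definition psdmx (C : numClosedFieldType) (n : nat) (A : 'M[C]_n) : Prop :=
  A \is hermsymmx /\ forall v : 'cV[C]_n, 0 <= (v ^t* *m A *m v) 0 0.

(* The relation X >= Y is only meaningful between Hermitian matrices, so their
   hermiticity is part of it. *)
Definition loewner_ge (C : numClosedFieldType) (n : nat) (X Y : 'M[C]_n) :
    Prop :=
  [/\ X \is hermsymmx, Y \is hermsymmx & psdmx (X - Y)].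

(* An element of M_m(M_n) is a matrix A : 'M_(m * n); the entry (k, l) of its
   block (i, j) sits at row mxtens_index (i, k) = i * n + k and column
   mxtens_index (j, l) = j * n + l, the layout of the Kronecker product tensmx
   (see tensmx_blk). *)
Definition blk (C : Type) (m n : nat) (A : 'M[C]_(m * n)) (i j : 'I_m) :
    'M[C]_n :=
  \matrix_(k, l) A (mxtens_index (i, k)) (mxtens_index (j, l)).

Lemma tensmx_blk (C : comPzRingType) (m n : nat) (X : 'M[C]_m) (Y : 'M[C]_n)
    (i j : 'I_m) :
  blk (tensmx X Y) i j = X i j *: Y.
Proof. by apply/matrixP => k l; rewrite [LHS]mxE tensmxE mxE. Qed.

Definition ptrace1 (C : pzRingType) (m n : nat) (A : 'M[C]_(m * n)) :
    'M[C]_n :=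
  \sum_(i < m) blk A i i.

Definition ptrace2 (C : pzRingType) (m n : nat) (A : 'M[C]_(m * n)) :
    'M[C]_m :=
  \matrix_(i, j) \tr (blk A i j).

(* Main.v *)
Require Import Defs.
From mathcomp Require Import all_boot all_order all_algebra.
From mathcomp Require Import complex mxtens.
From mathcomp Require Import reals ring.

Set Implicit Arguments.
Unset Strict Implicit.
Unset Printing Implicit Defensive.

Import Order.TTheory GRing.Theory Num.Theory.
Local Open Scope ring_scope.
Local Open Scope sesquilinear_scope.

(** Both inequalities say that, for a sign s, the matrix
    M = (tr A) I - s (tr_2 A) (x) I + s I (x) (tr_1 A) - A
    is positive semidefinite: s = 1 and s = - 1 give the lower and the upper
    sign of the theorem.

    For a rank one A = x x^*, let S and S' be the operators on two copies of
    C^m (x) C^n that exchange the two factors C^m, respectively the two factors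
    C^n. Each of the four terms of v^* M v is then the inner product of v (x) x
    with its image under one of 1, S, S', S S', so that
      v^* M v = <v (x) x, (1 - s S) (1 + s S') (v (x) x)>.
    Since S and S' are commuting self-adjoint involutions,
    P = (1 - s S) (1 + s S') is self-adjoint with P^2 = 4 P, whence
    4 v^* M v = |P (v (x) x)|^2 >= 0.

    The general case uses the same computation. The coordinate of
    P (v (x) x) at a pair t of basis indices has the form w_t^* x, where the
    vector w_t depends on v alone, and |w_t^* x|^2 = w_t^* A w_t. By linearity
    in A, 4 v^* M v = \sum_t w_t^* A w_t holds for every A, and each term is
    nonnegative when A is positive semidefinite. Here w_t is [twist] applied to
    the family [bitensor]; [sum_sesq_twist] is the identity P^* P = 4 P, and
    [sum_sesq_bitensor_twist] matches the four terms of P with those of M. *)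

(** * Hermitian matrices *)

Lemma hermsymmxP (C : numClosedFieldType) (n : nat) (A : 'M[C]_n) :
  reflect (forall i j, A i j = (A j i)^*) (A \is hermsymmx).
Proof.
apply: (iffP (is_hermitianmxP _ _ _)) => [AE i j|AE].
  by rewrite {1}AE expr0 scale1r !mxE.
by apply/matrixP => i j; rewrite expr0 scale1r !mxE.
Qed.

Lemma hermsymmxN (C : numClosedFieldType) (n : nat) (A : 'M[C]_n) :
  A \is hermsymmx -> - A \is hermsymmx.
Proof.
by move=> /hermsymmxP hA; apply/hermsymmxP => i j; rewrite !mxE hA rmorphN.
Qed.

Lemma hermsymmxD (C : numClosedFieldType) (n : nat) (A B : 'M[C]_n) :
  A \is hermsymmx -> B \is hermsymmx -> A + B \is hermsymmx.
Proof.
move=> /hermsymmxP hA /hermsymmxP hB; apply/hermsymmxP => i j.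
by rewrite !mxE hA hB rmorphD.
Qed.

Lemma hermsymmx_sign (C : numClosedFieldType) (n : nat) (b : bool)
    (A : 'M[C]_n) :
  A \is hermsymmx -> (-1) ^+ b *: A \is hermsymmx.
Proof.
by case: b; rewrite ?expr1 ?expr0 ?scaleN1r ?scale1r //; apply: hermsymmxN.
Qed.

Lemma hermsymmx1 (C : numClosedFieldType) (n : nat) :
  (1%:M : 'M[C]_n) \is hermsymmx.
Proof. by apply/hermsymmxP => i j; rewrite !mxE eq_sym rmorph_nat. Qed.

Lemma hermsymmx_trace_scalar (C : numClosedFieldType) (n k : nat)
    (A : 'M[C]_n) :
  A \is hermsymmx -> (\tr A *: 1%:M : 'M_k) \is hermsymmx.
Proof.
move=> /hermsymmxP hA; apply/hermsymmxP => i j.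
rewrite !mxE rmorphM rmorph_nat eq_sym rmorph_sum.
by congr (_ * _); apply: eq_bigr => k' _.
Qed.

Lemma hermsymmx_tens (C : numClosedFieldType) (m n : nat) (X : 'M[C]_m)
    (Y : 'M[C]_n) :
  X \is hermsymmx -> Y \is hermsymmx -> tensmx X Y \is hermsymmx.
Proof.
move=> /hermsymmxP hX /hermsymmxP hY; apply/hermsymmxP => i j.
by rewrite !mxE hX hY rmorphM.
Qed.

Lemma hermsymmx_ptrace1 (C : numClosedFieldType) (m n : nat)
    (A : 'M[C]_(m * n)) :
  A \is hermsymmx -> ptrace1 A \is hermsymmx.
Proof.
move=> /hermsymmxP hA; apply/hermsymmxP => k l.
rewrite !summxE rmorph_sum; apply: eq_bigr => i _.
by rewrite !mxE hA.
Qed.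

Lemma hermsymmx_ptrace2 (C : numClosedFieldType) (m n : nat)
    (A : 'M[C]_(m * n)) :
  A \is hermsymmx -> ptrace2 A \is hermsymmx.
Proof.
move=> /hermsymmxP hA; apply/hermsymmxP => i j.
rewrite !mxE rmorph_sum; apply: eq_bigr => k _.
by rewrite !mxE hA.
Qed.

(** * The sesquilinear form of a matrix *)

Definition sesq (C : numClosedFieldType) (n : nat) (A : 'M[C]_n)
    (u w : 'cV[C]_n) : C := (u^t* *m A *m w) 0 0.

Section Sesq.
Variables (C : numClosedFieldType) (n : nat).
Implicit Types (A B : 'M[C]_n) (u w : 'cV[C]_n).

Lemma sesqE A u w :
  sesq A u w = \sum_i \sum_j (u i 0)^* * A i j * w j 0.
Proof.
rewrite /sesq mxE exchange_big; apply: eq_bigr => j _.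
by rewrite mxE mulr_suml; apply: eq_bigr => i _; rewrite !mxE.
Qed.

Lemma sesqDl A u1 u2 w : sesq A (u1 + u2) w = sesq A u1 w + sesq A u2 w.
Proof. by rewrite /sesq !raddfD /= !mulmxDl mxE. Qed.

Lemma sesqNl A u w : sesq A (- u) w = - sesq A u w.
Proof. by rewrite /sesq !raddfN /= !mulNmx mxE. Qed.

Lemma sesqZl A c u w : sesq A (c *: u) w = c^* * sesq A u w.
Proof. by rewrite /sesq linearZ map_mxZ -!scalemxAl mxE. Qed.

Lemma sesqDr A u w1 w2 : sesq A u (w1 + w2) = sesq A u w1 + sesq A u w2.
Proof. by rewrite /sesq mulmxDr mxE. Qed.

Lemma sesqNr A u w : sesq A u (- w) = - sesq A u w.
Proof. by rewrite /sesq mulmxN mxE. Qed.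

Lemma sesqZr A c u w : sesq A u (c *: w) = c * sesq A u w.
Proof. by rewrite /sesq -scalemxAr mxE. Qed.

Lemma sesq_addmx A B u w : sesq (A + B) u w = sesq A u w + sesq B u w.
Proof. by rewrite /sesq mulmxDr mulmxDl mxE. Qed.

Lemma sesq_oppmx A u w : sesq (- A) u w = - sesq A u w.
Proof. by rewrite /sesq mulmxN mulNmx mxE. Qed.

Lemma sesq_scalemx c A u w : sesq (c *: A) u w = c * sesq A u w.
Proof. by rewrite /sesq -scalemxAr -scalemxAl mxE. Qed.

Lemma sesq_delta A c d p q :
  sesq A (c *: delta_mx p 0) (d *: delta_mx q 0) = c^* * d * A p q.
Proof.
rewrite sesqZl sesqZr mulrA sesqE; congr (_ * _).
rewrite (bigD1 p) //= [X in _ + X]big1 ?addr0 => [|i ip].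
  rewrite (bigD1 q) //= [X in _ + X]big1 ?addr0 => [|j jq].
    by rewrite !mxE !eqxx rmorph_nat mul1r mulr1.
  by rewrite !mxE (negbTE jq) mulr0.
by rewrite big1 // => j _; rewrite !mxE (negbTE ip) rmorph0 !mul0r.
Qed.

(** For the permutation operator g, self-adjoint because it is an involution,
    this moves g from F onto the eigenvector w. *)
Lemma sum_sesq_eigen A (T : finType) (g : T -> T) (F w : T -> 'cV[C]_n)
    (c : C) :
  involutive g -> (forall t, w (g t) = c *: w t) ->
  \sum_t sesq A (F (g t)) (w t) = c * \sum_t sesq A (F t) (w t).
Proof.
move=> gK wg; rewrite (reindex_inj (inv_inj gK)) mulr_sumr.
by apply: eq_bigr => t _; rewrite gK wg sesqZr.
Qed.

(** The image of the family F under (1 - s f) (1 + s g) with s = (-1) ^+ b,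
    where f and g act on families by reindexing. *)
Definition twist (b : bool) (T : finType) (f g : T -> T)
    (F : T -> 'cV[C]_n) (t : T) : 'cV[C]_n :=
  F t - (-1) ^+ b *: F (f t) + (-1) ^+ b *: F (g t) - F (f (g t)).

(** This is P^* P = 4 P for P = (1 - s f) (1 + s g). The twisted family is an
    eigenvector of f, g and f \o g, with eigenvalues - s, s and - 1; hence
    each of the four terms of its left copy contributes the same sum. *)
Lemma sum_sesq_twist A (b : bool) (T : finType) (f g : T -> T)
    (F : T -> 'cV[C]_n) :
  involutive f -> involutive g -> (forall t, f (g t) = g (f t)) ->
  \sum_t sesq A (twist b f g F t) (twist b f g F t) =
  (\sum_t sesq A (F t) (twist b f g F t)) *+ 4.
Proof.
move=> fK gK fg; set w := twist b f g F; set s : C := (-1) ^+ b.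
have ss : s * s = 1 by rewrite /s -expr2 sqrr_sign.
have sC : s^* = s by rewrite /s rmorph_sign.
have wf t : w (f t) = - s *: w t.
  rewrite /w /twist -/s fK -!fg fK.
  by apply/matrixP => i j; rewrite !mxE; ring: ss.
have wg t : w (g t) = s *: w t.
  rewrite /w /twist -/s gK.
  by apply/matrixP => i j; rewrite !mxE; ring: ss.
have fgK : involutive (f \o g) by move=> t; rewrite /= -fg gK fK.
have wfg t : w ((f \o g) t) = - 1 *: w t.
  by rewrite /= wf wg scalerA mulNr ss.
transitivity (\sum_t (sesq A (F t) (w t) - s * sesq A (F (f t)) (w t)
    + s * sesq A (F (g t)) (w t) - sesq A (F ((f \o g) t)) (w t))).
  apply: eq_bigr => t _.
  by rewrite {1}/w /twist !(sesqDl, sesqNl, sesqZl) -/s sC.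
rewrite !big_split /= !sumrN -!mulr_sumr.
rewrite (sum_sesq_eigen A F fK wf) (sum_sesq_eigen A F gK wg).
rewrite (sum_sesq_eigen A F fgK wfg).
by set x := \sum_t _; ring: ss.
Qed.

End Sesq.

(** * Partial traces as index exchanges *)

Section Forms.
Variables (C : numClosedFieldType) (m n : nat).
Variables (A : 'M[C]_(m * n)) (v : 'cV[C]_(m * n)).

Local Notation idx i a := (mxtens_index (i, a)).
Local Notation x i a := (v (idx i a) 0).

Lemma sum_mxtens (G : 'I_(m * n) -> C) :
  \sum_p G p = \sum_i \sum_a G (idx i a).
Proof.
rewrite pair_bigA (reindex (@mxtens_index m n)).
  by apply: eq_bigr => -[].
by exists (@mxtens_unindex m n) => ? _; rewrite (mxtens_indexK, mxtens_unindexK).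
Qed.

Definition swap_left (t : ('I_m * 'I_n) * ('I_m * 'I_n)) :=
  ((t.2.1, t.1.2), (t.1.1, t.2.2)).

Definition swap_right (t : ('I_m * 'I_n) * ('I_m * 'I_n)) :=
  ((t.1.1, t.2.2), (t.2.1, t.1.2)).

(** The functional x |-> (bitensor t)^* x reads off the coordinate of v (x) x
    at t; hence the conjugate. *)
Definition bitensor (t : ('I_m * 'I_n) * ('I_m * 'I_n)) : 'cV[C]_(m * n) :=
  (v (mxtens_index t.1) 0)^* *: delta_mx (mxtens_index t.2) 0.

Lemma sum_bitensor (G : ('I_m * 'I_n) * ('I_m * 'I_n) -> C) :
  \sum_t G t = \sum_i \sum_a \sum_j \sum_b G ((i, a), (j, b)).
Proof.
rewrite [RHS]pair_bigA; transitivity (\sum_p \sum_q G (p, q)).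
  by rewrite pair_bigA; apply: eq_bigr => -[].
by apply: eq_bigr => -[i a] _; rewrite pair_bigA; apply: eq_bigr => -[].
Qed.

Lemma sum_sesq_bitensor
    (g : ('I_m * 'I_n) * ('I_m * 'I_n) -> ('I_m * 'I_n) * ('I_m * 'I_n)) :
  \sum_t sesq A (bitensor t) (bitensor (g t)) =
  \sum_i \sum_a \sum_j \sum_b
    x i a * (v (mxtens_index (g ((i, a), (j, b))).1) 0)^*
    * A (idx j b) (mxtens_index (g ((i, a), (j, b))).2).
Proof.
rewrite sum_bitensor; apply: eq_bigr => i _; apply: eq_bigr => a _.
apply: eq_bigr => j _; apply: eq_bigr => b _.
by rewrite sesq_delta conjCK.
Qed.

(** In this and the next three lemmas, the indices exchanged in the right copy
    of the family (none, the first, the second or both) decide which indices of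
    A are traced out, the others being paired with those of v. *)
Lemma sesq_trace_scalar :
  sesq (\tr A *: 1%:M) v v =
  \sum_t sesq A (bitensor t) (bitensor t).
Proof.
rewrite (sum_sesq_bitensor id) /=.
rewrite sesqE sum_mxtens.
apply: eq_bigr => i _; apply: eq_bigr => a _.
rewrite (bigD1 (idx i a)) //= big1 ?addr0 => [|p pia].
  rewrite !mxE eqxx mulr1 /mxtrace sum_mxtens mulrAC [_^* * _]mulrC mulr_sumr.
  by apply: eq_bigr => j _; rewrite mulr_sumr.
by rewrite !mxE eq_sym (negbTE pia) !mulr0 mul0r.
Qed.

Lemma sesq_ptrace2 :
  sesq (tensmx (ptrace2 A) 1%:M) v v =
  \sum_t sesq A (bitensor t) (bitensor (swap_left t)).
Proof.
rewrite (sum_sesq_bitensor swap_left) /=.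
rewrite sesqE exchange_big sum_mxtens.
apply: eq_bigr => i _; apply: eq_bigr => a _.
rewrite sum_mxtens; apply: eq_bigr => j _.
rewrite (bigD1 a) //= big1 ?addr0 => [|c ca].
  rewrite tensmxE !mxE eqxx mulr1 mulrAC [_^* * _]mulrC mulr_sumr.
  by apply: eq_bigr => b _; rewrite mxE.
by rewrite tensmxE !mxE (negbTE ca) !mulr0 mul0r.
Qed.

Lemma sesq_ptrace1 :
  sesq (tensmx 1%:M (ptrace1 A)) v v =
  \sum_t sesq A (bitensor t) (bitensor (swap_right t)).
Proof.
rewrite (sum_sesq_bitensor swap_right) /=.
rewrite sesqE exchange_big sum_mxtens.
apply: eq_bigr => i _; apply: eq_bigr => a _.
rewrite sum_mxtens (bigD1 i) //= [X in _ + X]big1 ?addr0 => [|k ki].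
  rewrite exchange_big; apply: eq_bigr => b _.
  rewrite tensmxE !mxE eqxx mul1r mulrAC [_^* * _]mulrC summxE mulr_sumr.
  by apply: eq_bigr => j _; rewrite mxE.
rewrite big1 // => b _.
by rewrite tensmxE !mxE (negbTE ki) mul0r mulr0 mul0r.
Qed.

Lemma sesq_self :
  sesq A v v =
  \sum_t sesq A (bitensor t) (bitensor (swap_left (swap_right t))).
Proof.
rewrite (sum_sesq_bitensor (swap_left \o swap_right)) /=.
rewrite sesqE exchange_big sum_mxtens.
apply: eq_bigr => i _; apply: eq_bigr => a _; rewrite sum_mxtens.
by apply: eq_bigr => j _; apply: eq_bigr => b _; rewrite mulrC mulrA.
Qed.

Lemma sum_sesq_bitensor_twist (b : bool) :
  \sum_t sesq A (bitensor t) (twist b swap_left swap_right bitensor t) =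
  sesq (\tr A *: 1%:M - (-1) ^+ b *: tensmx (ptrace2 A) 1%:M
        + (-1) ^+ b *: tensmx 1%:M (ptrace1 A) - A) v v.
Proof.
rewrite !(sesq_addmx, sesq_oppmx) !(sesq_scalemx ((-1) ^+ b)).
rewrite sesq_trace_scalar sesq_ptrace2 sesq_ptrace1 sesq_self.
rewrite !mulr_sumr -!sumrN -!big_split /=; apply: eq_bigr => t _.
by rewrite /twist !(sesqDr, sesqNr, sesqZr).
Qed.

End Forms.

(** The quadratic form of this matrix at v is a quarter of a sum of values of
    the form of A, taken at the twisted vectors built from v. *)
Lemma psdmx_signed_ptraces (C : numClosedFieldType) (m n : nat)
    (A : 'M[C]_(m * n)) (b : bool) :
  psdmx A ->
  psdmx (\tr A *: 1%:M - (-1) ^+ b *: tensmx (ptrace2 A) (1%:M : 'M_n)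
         + (-1) ^+ b *: tensmx (1%:M : 'M_m) (ptrace1 A) - A).
Proof.
move=> [hA A_ge0]; split=> [|v].
  have h1 := hermsymmx_tens (hermsymmx1 C m) (hermsymmx_ptrace1 hA).
  have h2 := hermsymmx_tens (hermsymmx_ptrace2 hA) (hermsymmx1 C n).
  have ht := hermsymmx_trace_scalar (m * n) hA.
  apply: hermsymmxD (hermsymmxN hA).
  apply: hermsymmxD (hermsymmx_sign b h1).
  exact: hermsymmxD ht (hermsymmxN (hermsymmx_sign b h2)).
rewrite -[X in 0 <= X]/(sesq _ v v) -sum_sesq_bitensor_twist.
rewrite -(pmulrn_lge0 _ (isT : (0 < 4)%N)) -sum_sesq_twist.
- by apply: sumr_ge0 => t _; apply: A_ge0.
- by move=> [[i a] [j c]].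
- by move=> [[i a] [j c]].
- by move=> [[i a] [j c]].
Qed.

Theorem corollary2p6 (R : realType) (m n : nat) (m_ge1 : (1 <= m)%N)
    (n_ge1 : (1 <= n)%N) (A : 'M[R[i]%C]_(m * n)) (A_psd : psdmx A) :
  [/\ loewner_ge
        (\tr A *: 1%:M + tensmx (ptrace2 A) (1%:M : 'M_n))
        (A + tensmx (1%:M : 'M_m) (ptrace1 A)),
      loewner_ge
        (\tr A *: 1%:M - tensmx (ptrace2 A) (1%:M : 'M_n))
        (A - tensmx (1%:M : 'M_m) (ptrace1 A)),
      loewner_ge
        (\tr A *: 1%:M - A)
        (tensmx (1%:M : 'M_m) (ptrace1 A) - tensmx (ptrace2 A) (1%:M : 'M_n))
    & loewner_ge
        (\tr A *: 1%:M - A)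
        (- (tensmx (1%:M : 'M_m) (ptrace1 A)
            - tensmx (ptrace2 A) (1%:M : 'M_n)))].
Proof.
have hA := A_psd.1.
have h1 := hermsymmx_tens (hermsymmx1 _ m) (hermsymmx_ptrace1 hA).
have h2 := hermsymmx_tens (hermsymmx_ptrace2 hA) (hermsymmx1 _ n).
have ht := hermsymmx_trace_scalar (m * n) hA.
have hN1 := hermsymmxN h1; have hN2 := hermsymmxN h2.
have hNA := hermsymmxN hA.
(* The upper sign of the theorem is b = true, since b = true means s = - 1. *)
have := psdmx_signed_ptraces true A_psd; have := psdmx_signed_ptraces false A_psd.
rewrite expr0 expr1 !scale1r !scaleN1r opprK => psd_minus psd_plus.
split; split.
- exact: hermsymmxD ht h2.
- exact: hermsymmxD hA h1.
- by rewrite opprD [- A - _]addrC addrA.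
- exact: hermsymmxD ht hN2.
- exact: hermsymmxD hA hN1.
- by rewrite opprB addrA.
- exact: hermsymmxD ht hNA.
- exact: hermsymmxD h1 hN2.
- by rewrite opprB addrAC addrA.
- exact: hermsymmxD ht hNA.
- exact: hermsymmxN (hermsymmxD h1 hN2).
- by rewrite opprK addrAC [X in _ + X - A]addrC addrA.
Qed.
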